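(* Let $\ell\ge 2$ be an integer, let $G$ be a graph in $\mathcal{G}_{\ell}$, and let $S\subset V(G)$ be a set of vertices with $G[S]$ connected. Then: (i) for every edge $e$ of $G$ that is not contained in any cycle of length $2\ell+1$, the graph $G-e$ belongs to $\mathcal{G}_{\ell}$; (ii) if $G[L_i(S)]$ is bipartite for each $i\in\{1,\ldots,\lfloor \ell/2\rfloor\}$, then $G[L_i(S)]$ is bipartite for every integer $i>0$; (iii) $\chi(G)\le 4$.
   Context: All graphs are finite and simple. A hole is an induced cycle of length at least $4$; an odd hole is a hole of odd length. The girth of a graph is the length of a shortest cycle. For an integer $\ell\ge 2$, $\mathcal{G}_{\ell}$ denotes the family of graphs that have girth exactly $2\ell+1$ and have no odd holes of length at least $2\ell+3$. For a vertex $x$ and a nonempty set $S\subseteq V(G)$, $d(x,S)=\min\{d(x,y):y\in S\}$ (graph distance), and $L_i(S)=\{x\in V(G): d(x,S)=i\}$ for each integer $i\ge 0$. $G[X]$ denotes the subgraph induced by $X$, and $\chi(G)$ is the chromatic number. *)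

(* Defs.v *)
From HB Require Import structures.
From mathcomp Require Import all_boot.
Set Implicit Arguments.
Unset Strict Implicit.
Unset Printing Implicit Defensive.

Record sgraph := SGraph {
  vertex :> finType;
  edge : rel vertex;
  edge_sym : symmetric edge;
  edge_irrefl : irreflexive edge }.

Section Subgraphs.
Variable G : sgraph.

Definition induced_edge (X : {set G}) : rel {x : G | x \in X} :=
  fun u v => edge (val u) (val v).

Lemma induced_sym X : symmetric (@induced_edge X).
Proof. by move=> u v; apply: edge_sym. Qed.

Lemma induced_irrefl X : irreflexive (@induced_edge X).
Proof. by move=> u; apply: edge_irrefl. Qed.

Definition induced (X : {set G}) : sgraph :=
  SGraph (@induced_sym X) (@induced_irrefl X).

Definition del_edge_rel (x y : G) : rel G :=
  fun u v => edge u v && ([set u; v] != [set x; y]).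

Lemma del_edge_sym x y : symmetric (del_edge_rel x y).
Proof. by move=> u v; rewrite /del_edge_rel edge_sym setUC. Qed.

Lemma del_edge_irrefl x y : irreflexive (del_edge_rel x y).
Proof. by move=> u; rewrite /del_edge_rel edge_irrefl. Qed.

Definition del_edge (x y : G) : sgraph :=
  SGraph (@del_edge_sym x y) (@del_edge_irrefl x y).

End Subgraphs.

Section Invariants.
Variable G : sgraph.

(* Cycles are listed by their vertices in cyclic order, without repeating the
   first vertex at the end, so that [size c] is the length of the cycle. *)
Definition is_cycle (c : seq G) : bool :=
  [&& 3 <= size c, uniq c & cycle (@edge G) c].

Definition cycle_edge (c : seq G) (x y : G) : bool :=
  [&& x \in c, y \in c & (next c x == y) || (next c y == x)].

Definition is_hole (c : seq G) : Prop :=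
  [/\ is_cycle c, 4 <= size c &
      forall x y, x \in c -> y \in c -> edge x y -> cycle_edge c x y].

(* No [k] satisfies this when [G] is a forest (infinite girth). *)
Definition has_girth (k : nat) : Prop :=
  (exists2 c : seq G, is_cycle c & size c = k) /\
  (forall c : seq G, is_cycle c -> k <= size c).

Definition in_family (l : nat) : Prop :=
  has_girth (2 * l + 1) /\
  ~ (exists c : seq G, [/\ is_hole c, odd (size c) & 2 * l + 3 <= size c]).

Definition connected : Prop := forall x y : G, connect (@edge G) x y.

Definition bipartite : Prop :=
  exists A : {set G}, forall x y : G, edge x y -> (x \in A) != (y \in A).

Definition walk (n : nat) (x y : G) : bool :=
  [exists p : n.-tuple G, path (@edge G) x p && (last x p == y)].

(* [dist_is x y n] reads d(x,y) = n; it fails for every [n] when [x] and [y]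
   lie in different components. *)
Definition dist_is (x y : G) (n : nat) : bool :=
  walk n x y && [forall m : 'I_n, ~~ walk m x y].

(* [setdist_is x S n] reads min {d(x,y) : y in S} = n. *)
Definition setdist_is (x : G) (S : {set G}) (n : nat) : bool :=
  [exists y in S, dist_is x y n] &&
  [forall y in S, [forall m : 'I_n, ~~ dist_is x y m]].

Definition level (S : {set G}) (i : nat) : {set G} :=
  [set x | setdist_is x S i].

Definition colorable (k : nat) : bool :=
  [exists f : {ffun G -> 'I_k},
    [forall x, [forall y, edge x y ==> (f x != f y)]]].

Lemma colorable_exists : exists k, colorable k.
Proof.
exists #|G|; apply/existsP; exists [ffun x => enum_rank x].
apply/forallP=> x; apply/forallP=> y; apply/implyP=> exy.
rewrite !ffunE; apply/eqP=> /enum_rank_inj xy.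
by rewrite xy edge_irrefl in exy.
Qed.

Definition chromatic_number : nat := ex_minn colorable_exists.

End Invariants.

(* Main.v *)
Require Import Defs.
From mathcomp Require Import all_boot zify.

Set Implicit Arguments.
Unset Strict Implicit.
Unset Printing Implicit Defensive.

(* (i) An odd hole of G - e which is not a hole of G has e as its only chord;
   e cuts it into two holes of G, exactly one of them odd, and this one is a
   long odd hole or a (2l+1)-cycle through e.

   (ii) At the first non-bipartite level L_i(S) with i > m := l./2 there is an
   odd hole C, of length 2l+1. Let Z be the set of vertices at distance at most
   i-m-1 from S, and attach to each vertex v of C a descending path (a "leg")
   of length m, ending at w(v) at distance 1 from Z. If a and b are at distance
   l on C and joined through vertices not adjacent to the rest of C, then a
   shortest such connection closes up with one of the two arcs of C to an odd
   hole, hence has length l+1. If l is even this gives w(a) ~ w(b), and stepping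
   by l around C yields an odd closed walk in L_{i-m}(S). If l is odd, every
   connected subset of Z adjacent to w(a) and w(b) contains a common neighbour
   of both; adding vertices to a connected set one at a time shows that then no
   connected subset of Z is adjacent to all w(v), although Z itself is.

   (iii) With S a single vertex the levels up to l./2 have no edges, so all
   levels are bipartite; colour by the parity of the level and the side. *)

(** * Walks *)

Section Walks.
Variables (T : finType) (R : rel T).

(** Recording only length and ends makes joining and cutting walks easy. The relation is arbitrary
    so that walks can later be confined to a vertex set. *)
Fixpoint wlk n (x y : T) : bool :=
  if n is m.+1 then [exists z, R x z && wlk m z y] else x == y.

Lemma wlkS n x z y : R x z -> wlk n z y -> wlk n.+1 x y.
Proof. by move=> h1 h2; apply/existsP; exists z; rewrite h1. Qed.

Lemma wlk_cat n p x y z : wlk n x y -> wlk p y z -> wlk (n + p) x z.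
Proof.
elim: n x => [|n IH] x; first by move=> /eqP ->.
move=> /existsP[u /andP[xu uy]] yz; rewrite addSn.
exact: (wlkS xu (IH _ uy yz)).
Qed.

Lemma wlk1 x y : R x y -> wlk 1 x y.
Proof. by move=> xy; apply: (wlkS xy); rewrite /= eqxx. Qed.

Lemma wlk_sym : symmetric R -> forall n x y, wlk n x y -> wlk n y x.
Proof.
move=> sR; elim=> [|n IH] x y; first by move=> /=; rewrite eq_sym.
move=> /existsP[u /andP[xu uy]]; rewrite -addn1.
by apply: wlk_cat (IH _ _ uy) _; apply: wlk1; rewrite sR.
Qed.

Lemma wlk_fun n x y : wlk n x y ->
  exists f : nat -> T, [/\ f 0 = x, f n = y & forall t, t < n -> R (f t) (f t.+1)].
Proof.
elim: n x => [|n IH] x; first by move=> /eqP <-; exists (fun=> x).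
move=> /existsP[u /andP[xu /IH[f [f0 fn fR]]]].
exists (fun t => if t is t'.+1 then f t' else x); split=> //.
by case=> [|t] //=; [rewrite f0 | rewrite ltnS; apply: fR].
Qed.

Lemma fun_wlk (f : nat -> T) a d :
  (forall t, a <= t < a + d -> R (f t) (f t.+1)) -> wlk d (f a) (f (a + d)).
Proof.
elim: d a => [|d IH] a h; first by rewrite addn0 /=.
apply: (@wlkS _ _ (f a.+1)); first by apply: h; lia.
by rewrite -addSnnS; apply: IH => t ht; apply: h; lia.
Qed.

Lemma connect_wlk x y : connect R x y -> exists n, wlk n x y.
Proof.
case/connectP=> p; elim: p x => [|z p IH] x /=.
  by move=> _ ->; exists 0; rewrite /= eqxx.
by case/andP=> xz zp yp; have [n hn] := IH _ zp yp; exists n.+1; apply: wlkS hn.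
Qed.

(** A repeated vertex or a forward chord would allow a shortcut, so minimal length makes the walk an
    induced path. *)
Lemma shortest_wlk n x y : wlk n x y ->
  exists q, exists f : nat -> T,
    [/\ f 0 = x, f q = y, (forall t, t < q -> R (f t) (f t.+1)),
        (forall i j, i < j <= q -> f i != f j /\ (R (f i) (f j) -> j = i.+1))
      & forall k, wlk k x y -> q <= k].
Proof.
move=> h; case: (ex_minnP (ex_intro (fun k => wlk k x y) n h)) => q hq qmin.
have [f [f0 fq fR]] := wlk_fun hq; exists q, f; split=> // i j ij.
have pre : wlk i x (f i).
  by rewrite -{1}f0 -[i in f i]add0n; apply: fun_wlk => t ht; apply: fR; lia.
have suf : wlk (q - j) (f j) y.
  have e : q = j + (q - j) by lia.
  by rewrite -fq {2}e; apply: fun_wlk => t ht; apply: fR; lia.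
split=> [|Rij].
  apply/eqP=> e; rewrite -e in suf.
  by have := qmin _ (wlk_cat pre suf); lia.
by have := qmin _ (wlk_cat pre (wlkS Rij suf)); lia.
Qed.

End Walks.

Lemma sub_wlk (T : finType) (R R' : rel T) n x y :
  subrel R R' -> wlk R n x y -> wlk R' n x y.
Proof.
move=> sR; elim: n x => [|n IH] x //= /existsP[z /andP[xz zy]].
by apply/existsP; exists z; rewrite sR //= IH.
Qed.

(** * Cycles and holes *)

Section Cycles.
Variable G : sgraph.
Implicit Types (f g : nat -> G) (n q r : nat).

Definition fcycle f n :=
  [/\ 3 <= n, (forall t, t.+1 < n -> edge (f t) (f t.+1)), edge (f n.-1) (f 0)
    & forall i j, i < j < n -> f i != f j].

Definition chordless f n := forall i j, i < j < n -> edge (f i) (f j) ->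
  j = i.+1 \/ (i = 0 /\ j = n.-1).

Definition ipath f r :=
  (forall t, t < r -> edge (f t) (f t.+1)) /\
  (forall i j, i < j <= r -> f i != f j /\ (edge (f i) (f j) -> j = i.+1)).


(** A chordless cycle unrolled periodically, so that an arc may start anywhere and run past the
    index [0] without case distinctions. *)
Definition pcyc f n := [/\ 3 <= n, (forall t, f (t + n) = f t),
  (forall t, edge (f t) (f t.+1)) &
  forall i j, i < j < i + n ->
    f i != f j /\ (edge (f i) (f j) -> j = i.+1 \/ j.+1 = i + n)].

Lemma fcycle_inj f n : fcycle f n ->
  forall i j, i < n -> j < n -> f i = f j -> i = j.
Proof.
case=> _ _ _ fI i j hi hj e; case: (ltngtP i j) => // ij.
  by have := fI i j; rewrite e eqxx ij hj; move/(_ isT).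
by have := fI j i; rewrite e eqxx ij hi; move/(_ isT).
Qed.

Lemma fcycle_is_cycle f n : fcycle f n -> is_cycle (mkseq f n).
Proof.
move=> fc; have fI := fcycle_inj fc; case: fc => n3 fE fL _.
rewrite /is_cycle size_mkseq n3 /=; apply/andP; split.
  by rewrite map_inj_in_uniq ?iota_uniq // => i j; rewrite !mem_iota => hi hj; apply: fI.
case: n n3 fE fL {fI} => // n _ fE fL.
apply/(pathP (f 0)) => t; rewrite size_rcons size_map size_iota => ht.
rewrite -[X in rcons X _]/(map f (iota 1 n)).
set s := map f (iota 1 n); have sz : size s = n by rewrite size_map size_iota.
have e k : k < n -> nth (f 0) (rcons s (f 0)) k = f k.+1.
  by move=> hk; rewrite nth_rcons sz hk (nth_map 0) ?size_iota // nth_iota.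
have e0 : nth (f 0) (rcons s (f 0)) n = f 0 by rewrite nth_rcons sz ltnn eqxx.
have -> : nth (f 0) (f 0 :: rcons s (f 0)) t = f t by case: t ht => //= t; exact: e.
move: ht; rewrite ltnS leq_eqVlt => /orP[/eqP->|ht]; first by rewrite e0.
by rewrite e //; apply: fE.
Qed.

Lemma fcycle_hole f n : 4 <= n -> fcycle f n -> chordless f n ->
  is_hole (mkseq f n).
Proof.
move=> n4 fc fch; split; [exact: fcycle_is_cycle|by rewrite size_mkseq|].
have fI := fcycle_inj fc; case: fc => _ fE fL _.
have U : uniq (mkseq f n).
  by rewrite map_inj_in_uniq ?iota_uniq // => i j; rewrite !mem_iota => hi hj; apply: fI.
have I t : t < n -> index (f t) (mkseq f n) = t.
  by move=> ht; rewrite -{1}(nth_mkseq (f 0) f ht) index_uniq ?size_mkseq.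
have N t : t.+1 < n -> next (mkseq f n) (f t) = f t.+1.
  move=> ht; have mt : f t \in mkseq f n by apply: map_f; rewrite mem_iota; lia.
  rewrite next_nth mt.
  have ix := I t ltac:(lia).
  case: n {n4 fch fI fE fL U I mt} ht ix => // n ht -> /=.
  by rewrite (nth_map 0) ?size_iota // nth_iota.
have NL : next (mkseq f n) (f n.-1) = f 0.
  have mt : f n.-1 \in mkseq f n by apply: map_f; rewrite mem_iota; lia.
  rewrite next_nth mt.
  have ix := I n.-1 ltac:(lia).
  case: n {n4 fch fI fE fL U I mt N} ix => // n -> /=.
  by rewrite nth_default // size_map size_iota.
have key i j : i < j < n -> edge (f i) (f j) ->
    (next (mkseq f n) (f i) == f j) || (next (mkseq f n) (f j) == f i).
  move=> ij e; case: (fch i j ij e) => [ej|[-> ej]].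
    by subst j; rewrite N ?eqxx //; lia.
  by rewrite ej NL eqxx orbT.
move=> x y xc yc exy; rewrite /cycle_edge xc yc /=.
case/mapP: xc exy => i; rewrite mem_iota => hi -> ; case/mapP: yc => j.
rewrite mem_iota => hj ->; case: (ltngtP i j) => [ij|ji|->].
- by apply: key; lia.
- by rewrite edge_sym orbC; apply: key; lia.
- by rewrite edge_irrefl.
Qed.

Lemma fcycle_pcyc f n : fcycle f n -> chordless f n ->
  pcyc (fun t => f (t %% n)) n.
Proof.
move=> fc fch; have fI := fcycle_inj fc; case: fc => n3 fE fL fI'.
have n0 : 0 < n by lia.
split=> // [t|t|i j /andP[ij ijn]]; first by rewrite modnDr.
- have := ltn_pmod t n0; rewrite -(addn1 t) -modnDml addn1.
  move: (t %% n) => u; rewrite leq_eqVlt => /orP[/eqP un|un].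
    by rewrite un modnn (_ : u = n.-1) //; lia.
  by rewrite modn_small //; apply: fE.
have hi := ltn_pmod i n0.
have [d [ed d0 dn]] : exists d, [/\ j = i + d, 0 < d & d < n].
  by exists (j - i); split; lia.
rewrite ed -modnDml; set u := i %% n in hi *; clearbody u.
case: (ltnP (u + d) n) => h.
  rewrite modn_small //; split; first by apply: fI'; lia.
  by move=> e; have := fch u (u + d) ltac:(lia) e; lia.
have -> : (u + d) %% n = u + d - n.
  by rewrite -{1}(subnK h) modnDr modn_small //; lia.
split; first by rewrite eq_sym; apply: fI'; lia.
by rewrite edge_sym => e; have := fch (u + d - n) u ltac:(lia) e; lia.
Qed.

Lemma pcyc_mod f n t : pcyc f n -> f t = f (t %% n).
Proof.
case=> _ fP _ _; rewrite {1}(divn_eq t n) addnC.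
by elim: (t %/ n) => [|k IH]; rewrite ?addn0 // mulSnr addnA fP.
Qed.

Lemma pcyc_ipath f n a r : pcyc f n -> r.+1 < n -> ipath (fun t => f (a + t)) r.
Proof.
case=> n3 fP fE fI hr; split=> [t _|i j ij]; first by rewrite addnS.
have [h1 h2] := fI (a + i) (a + j) ltac:(lia).
by split=> // /h2; lia.
Qed.

Lemma pcyc_shift f n a : pcyc f n -> pcyc (fun t => f (a + t)) n.
Proof.
case=> n3 fP fE fI; split=> // [t|t|i j ij]; rewrite ?addnA ?addnS //.
have [h1 h2] := fI (a + i) (a + j) ltac:(lia).
by split=> // /h2; lia.
Qed.

Lemma ipath_rev f r : ipath f r -> ipath (fun t => f (r - t)) r.
Proof.
case=> fE fI; split=> [t ht|i j ij].
  rewrite edge_sym (_ : r - t = (r - t.+1).+1); last lia.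
  by apply: fE; lia.
have [h1 h2] := fI (r - j) (r - i) ltac:(lia).
by rewrite eq_sym edge_sym; split=> // /h2; lia.
Qed.

(** The main source of holes: two induced paths with common ends and no contact between their
    interiors. A pair of vertices not separated by the paths lies on one of them, where inducedness
    applies. *)
Lemma glue_cycle f g r q : 2 <= r -> 2 <= q -> ipath f r -> ipath g q ->
  g 0 = f r -> g q = f 0 ->
  (forall i s, 0 < i < r -> 0 < s < q -> f i != g s /\ ~~ edge (f i) (g s)) ->
  let h := fun t => if t < r then f t else g (t - r) in
  fcycle h (r + q) /\ chordless h (r + q).
Proof.
move=> r2 q2 [fE fI] [gE gI] g0 gq fg h.
have hf t : t <= r -> h t = f t.
  move=> ht; rewrite /h; case: ltnP => // rt.
  by rewrite (_ : t - r = 0) ?g0; [congr f|]; lia.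
have hg t : h (r + t) = g t by rewrite /h ltnNge leq_addr /= addKn.
have X i j : i < j < r + q ->
    h i != h j /\ (edge (h i) (h j) -> j = i.+1 \/ i = 0 /\ j = (r + q).-1).
  move=> ij; case: (leqP j r) => jr.
    rewrite !hf //; last lia.
    by have [h1 h2] := fI i j ltac:(lia); split=> // /h2; lia.
  have -> : j = r + (j - r) by lia.
  rewrite hg; case: (leqP r i) => ir.
    rewrite (_ : i = r + (i - r)); last lia.
    rewrite hg; have [h1 h2] := gI (i - r) (j - r) ltac:(lia).
    by split=> // /h2; lia.
  rewrite hf; last lia.
  (* The vertex [f 0] is also the end [g q], so a pair containing it is handled on [g]. *)
  case: (posnP i) => [->|i0].
    rewrite -gq; have [h1 h2] := gI (j - r) q ltac:(lia).
    by rewrite eq_sym edge_sym; split=> // /h2; lia.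
  have [h1 h2] := fg i (j - r) ltac:(lia) ltac:(lia).
  by split=> // e; rewrite e in h2.
split; last by move=> i j ij; apply: (X i j ij).2.
split; [lia| | |by move=> i j ij; apply: (X i j ij).1].
  move=> t ht; case: (ltnP t r) => tr; first by rewrite !hf; [apply: fE|lia|lia].
  have -> : t = r + (t - r) by lia.
  by rewrite -addnS !hg; apply: gE; lia.
rewrite (hf 0) // -gq (_ : (r + q).-1 = r + q.-1); last lia.
by rewrite hg -[in X in edge _ X](@prednK q); [apply: gE|]; lia.
Qed.

End Cycles.

(** Colour a vertex by the parity of a shortest walk to it from the root of its component; an edge
    inside a class would close an odd walk at the root. *)
Lemma bipartite_no_odd_walk (H : sgraph) :
  (forall n (x : H), wlk (@edge H) n x x -> ~~ odd n) -> bipartite H.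
Proof.
move=> hH; have sc : connect_sym (@edge H) := sym_connect_sym (@edge_sym H).
have hw (x : H) : exists n, wlk (@edge H) n (root (@edge H) x) x.
  by apply: connect_wlk; rewrite sc connect_root.
exists [set x | odd (ex_minn (hw x))] => x y xy; rewrite !inE.
case: ex_minnP => a wa _; case: ex_minnP => b wb _.
have er : root (@edge H) x = root (@edge H) y by apply/eqP; rewrite root_connect // connect1.
rewrite -er in wb.
have := hH _ _ (wlk_cat (wlk_cat wa (wlk1 xy)) (wlk_sym (@edge_sym H) wb)).
by rewrite !oddD; case: (odd a); case: (odd b).
Qed.

(** * Shortest odd closed walks inside a vertex set *)

Section OddCycles.
Variable G : sgraph.
Implicit Types (f g : nat -> G) (n q r : nat) (X : {set G}).

Definition redge X : rel G := fun u v => [&& edge u v, u \in X & v \in X].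

Lemma redge_sym X : symmetric (redge X).
Proof. by move=> u v; rewrite /redge edge_sym [(u \in X) && _]andbC. Qed.

Lemma redge_sub X (Y : {set G}) : X \subset Y -> subrel (redge X) (redge Y).
Proof. by move=> /subsetP s u v /and3P[e a b]; rewrite /redge e !s. Qed.

(** In a shortest odd closed walk, a repetition or a chord cuts off two closed walks, exactly one of
    them odd. By minimality the odd one is not shorter, which rules out repetitions and leaves only
    chords that are cycle edges. *)
Lemma odd_closed_walk X n x : wlk (redge X) n x x -> odd n ->
  exists f k, [/\ k <= n, odd k, fcycle f k, chordless f k & forall t, t < k -> f t \in X].
Proof.
move=> w on.
(* Minimality ranges over all base points, because the pieces cut off start elsewhere. *)
pose P k := odd k && [exists x, wlk (redge X) k x x].
have exP : exists k, P k by exists n; rewrite /P on; apply/existsP; exists x.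
case: (ex_minnP exP) => k /andP[ok /existsP[y wy]] kmin.
have kn : k <= n by apply: kmin; rewrite /P on; apply/existsP; exists x.
have {}kmin q z : wlk (redge X) q z z -> odd q -> k <= q.
  by move=> wz oq; apply: kmin; rewrite /P oq; apply/existsP; exists z.
have [f [f0 fk fR]] := wlk_fun wy; exists f, k.
have inX t : t < k -> f t \in X by move=> /fR /and3P[].
have fE t : t < k -> edge (f t) (f t.+1) by move=> /fR /and3P[].
have k3 : 3 <= k.
  case: (k) ok fE f0 fk => [|[|[|?]]] // _ fE f0 fk.
  by have := fE 0 isT; rewrite f0 fk edge_irrefl.
have seg i j : i < j < k -> wlk (redge X) (j - i) (f i) (f j) /\
    wlk (redge X) (k - (j - i)) (f j) (f i).
  move=> ij; split.
    have e : j = i + (j - i) by lia.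
    by rewrite {2}e; apply: fun_wlk => t ht; apply: fR; lia.
  have -> : k - (j - i) = (k - j) + i by lia.
  apply: (@wlk_cat _ _ _ _ _ (f 0)).
    rewrite f0 -fk; have e : k = j + (k - j) by lia.
    by rewrite {2}e; apply: fun_wlk => t ht; apply: fR; lia.
  by rewrite -{2}[i]add0n; apply: fun_wlk => t ht; apply: fR; lia.
split=> //.
- split=> // [t ht||i j ij]; first by apply: fE; lia.
    by rewrite f0 -fk -[in X in edge _ X](@prednK k); [apply: fE|]; lia.
  apply/eqP=> e; have [] := seg i j ij; rewrite e => w1 w2.
  by have := kmin _ _ w1; have := kmin _ _ w2; lia.
- move=> i j ij e; have [w1 w2] := seg i j ij.
  have r1 : redge X (f i) (f j) by rewrite /redge e !inX //; lia.
  have r2 : redge X (f j) (f i) by rewrite redge_sym.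
  have := kmin _ _ (wlk_cat w1 (wlk1 r2)); have := kmin _ _ (wlk_cat w2 (wlk1 r1)).
  by lia.
Qed.

Lemma induced_wlk X n (x y : induced X) :
  wlk (@edge (induced X)) n x y -> wlk (redge X) n (val x) (val y).
Proof.
elim: n x => [|n IH] x /=; first by move/eqP->.
case/existsP=> z /andP[xz zy]; apply: wlkS (IH _ zy).
by apply/and3P; split; [exact: xz|exact: valP x|exact: valP z].
Qed.

Lemma not_bipartite_odd_cycle X :
  (forall f k, odd k -> fcycle f k -> chordless f k ->
     (forall t, t < k -> f t \in X) -> False) ->
  bipartite (induced X).
Proof.
move=> h; apply: bipartite_no_odd_walk => n x w; apply/negP=> on.
by have [f [k [_ ok fc ch fX]]] := odd_closed_walk (induced_wlk w) on; apply: h fX.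
Qed.

Lemma bipartite_even_walk X : bipartite (induced X) ->
  exists A : {set G}, forall n u v, wlk (redge X) n u v -> 
   (u \in A) (+) (v \in A) = odd n.
Proof.
case=> A hA; exists [set val x | x in A]; elim=> [|n IH] u v /=.
  by move/eqP->; rewrite addbb.
case/existsP=> z /andP[/and3P[uz uX zX] /IH zv]; rewrite -zv.
have mA y (yX : y \in X) : (y \in [set val x | x in A]) = (exist _ y yX \in A).
  exact: (mem_imset A (exist _ y yX) val_inj).
have := hA (exist _ u uX) (exist _ z zX) uz.
by rewrite (mA u uX) (mA z zX); do 3 case: (_ \in _).
Qed.

End OddCycles.

(** * Odd holes and short connections in a graph of the family *)

Section Family.
Variables (l : nat) (G : sgraph).
Hypotheses (hl : 2 <= l) (hG : in_family G l).
Implicit Types (f g : nat -> G) (n q r : nat) (X : {set G}).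

Lemma fcycle_girth f n : fcycle f n -> 2 * l + 1 <= n.
Proof. by move=> /fcycle_is_cycle /hG.1.2; rewrite size_mkseq. Qed.

Lemma odd_hole_length f n : fcycle f n -> chordless f n -> odd n -> n = 2 * l + 1.
Proof.
move=> fc ch on; have gn := fcycle_girth fc.
case: (leqP (2 * l + 3) n) => hn; last by lia.
case: hG.2; exists (mkseq f n); rewrite size_mkseq; split=> //.
by apply: fcycle_hole => //; lia.
Qed.

Lemma odd_closed_walk_length n (x : G) : wlk (@edge G) n x x -> odd n -> 2 * l + 1 <= n.
Proof.
move=> w on; have w' : wlk (redge setT) n x x.
  by apply: sub_wlk w => u v uv; rewrite /redge uv !inE.
by have [f [k [kn _ fc _ _]]] := odd_closed_walk w' on; have := fcycle_girth fc; lia.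
Qed.

Lemma pcyc_one_neighbor f (x : G) i j : pcyc f (2 * l + 1) ->
  (forall t, x != f t) -> edge x (f i) -> edge x (f j) -> f i = f j.
Proof.
move=> fc xf; rewrite (pcyc_mod i fc) (pcyc_mod j fc).
have n0 : 0 < 2 * l + 1 by lia.
have := ltn_pmod i n0; have := ltn_pmod j n0.
move: (i %% _) (j %% _) => {}i {}j.
suff K i' j' : i' < j' < 2 * l + 1 -> edge x (f i') -> edge x (f j') -> False.
  move=> hj hi xi xj; case: (ltngtP i j) => [ij|ji|->] //.
    by case: (K i j); rewrite ?ij.
  by case: (K j i); rewrite ?ji.
move: i' j' => {}i {}j ij xi xj.
(* Two neighbours at distance [r <= l] along the hole close a cycle of length [r + 2] through [x],
   below the girth because [l >= 2]. *)
have H a r : 0 < r <= l -> edge x (f a) -> edge x (f (a + r)) -> False.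
  case: fc => _ _ fE fI hr xa xr.
  suff /fcycle_girth : fcycle (fun t => if t is t'.+1 then f (a + t') else x) (r + 2) by lia.
  split; first lia.
  - by case=> [|t] ht; rewrite ?addn0 // addnS.
  - by rewrite addn2 /= edge_sym.
  case=> [|i'] [|j'] // hij.
  by apply: (fI _ _ _).1; lia.
case: fc => _ fP _ _.
case: (leqP (j - i) l) => h.
  by apply: (H i (j - i)) => //; [lia|rewrite (_ : i + _ = j) //; lia].
apply: (H j (i + (2 * l + 1) - j)) => //; first lia.
by rewrite (_ : j + _ = i + (2 * l + 1)) ?fP //; lia.
Qed.

(* The two arcs of the cycle have lengths [l] and [l + 1], of different
   parity, so the path closes up with one of them to an odd hole. *)
Lemma pcyc_shortest_path f X n : pcyc f (2 * l + 1) -> (forall t, f t \notin X) ->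
  (forall x t, x \in X -> edge x (f t) -> f t = f 0 \/ f t = f l) ->
  wlk (redge (f 0 |: (f l |: X))) n (f 0) (f l) ->
  (exists g, [/\ g 0 = f 0, g l.+1 = f l, (forall t, t <= l -> edge (g t) (g t.+1))
                & forall t, 0 < t <= l -> g t \in X]) /\
  (forall k, wlk (redge (f 0 |: (f l |: X))) k (f 0) (f l) -> l.+1 <= k).
Proof.
move=> fc fX hX w; have [q [g [g0 gq gE gI gmin]]] := shortest_wlk w.
set Y := _ |: _ in w gE gI gmin *.
have [n3 fP fE fI] := fc.
have f0l := fI 0 l ltac:(lia).
have q2 : 2 <= q.
  case: (q) g0 gq gE => [|[|?]] // g0 gq gE.
    by move: f0l.1; rewrite -g0 -gq eqxx.
  have := gE 0 isT; rewrite g0 gq => /and3P[/f0l.2]; lia.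
have gY t : t <= q -> g t \in Y.
  case: t => [|t] ht; last by have /and3P[] := gE t ht.
  by rewrite g0 !inE eqxx.
have gX t : 0 < t < q -> g t \in X.
  move=> ht; have := gY t ltac:(lia); rewrite !inE -g0 -gq.
  have [/negbTE h _] := gI 0 t ltac:(lia); rewrite eq_sym h.
  by have [/negbTE-> _] := gI t q ltac:(lia).
have gp : ipath g q.
  split=> [t /gE /and3P[] //|i j ij]; have [h1 h2] := gI i j ij.
  by split=> // e; apply: h2; rewrite /redge e !gY //; lia.
(* Interior vertices of either arc differ from [f 0] and [f l], the only hole vertices with
   neighbours in [X]. The disjunction covers both arcs, of lengths [l] and [l.+1]. *)
have off a r i s :
    (f a = f 0 /\ f (a + r) = f l) \/ (f a = f l /\ f (a + r) = f 0) ->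
    r < 2 * l -> 0 < i < r -> 0 < s < q -> f (a + i) != g s /\ ~~ edge (f (a + i)) (g s).
  move=> ar rl hi hs; have gs := gX s hs; split.
    by apply: contraNneq (fX (a + i)) => ->.
  rewrite edge_sym; apply/negP=> /(hX _ _ gs).
  have [/eqP n1 _] := fI a (a + i) ltac:(lia).
  have [/eqP n2 _] := fI (a + i) (a + r) ltac:(lia).
  by case: ar => -[e1 e2]; rewrite -e1 -e2 => -[e|e]; [apply: n1|apply: n2|apply: n2|apply: n1].
have [p1 p2] : ipath (fun t => f (0 + t)) l /\ ipath (fun t => f (l + t)) l.+1.
  by split; apply: (pcyc_ipath _ fc); lia.
have fl2 : f (l + l.+1) = f 0 by rewrite (_ : l + l.+1 = 0 + (2 * l + 1)) ?fP //; lia.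
have [g0' gq'] : g (q - 0) = f (0 + l) /\ g (q - q) = f (0 + 0) by rewrite subn0 subnn.
have off1 i s : 0 < i < l -> 0 < s < q ->
    f (0 + i) != g (q - s) /\ ~~ edge (f (0 + i)) (g (q - s)).
  by move=> hi hs; apply: (off 0 l); [left|lia|lia|lia].
have [fc1 ch1] := glue_cycle hl q2 p1 (ipath_rev gp) g0' gq' off1.
have [g0'' gq''] : g 0 = f (l + l.+1) /\ g q = f (l + 0) by rewrite fl2 addn0.
have off2 i s : 0 < i < l.+1 -> 0 < s < q ->
    f (l + i) != g s /\ ~~ edge (f (l + i)) (g s).
  by move=> hi hs; apply: (off l l.+1); [right|lia|lia|lia].
have [fc2 ch2] := glue_cycle (ltnW hl : 2 <= l.+1) q2 p2 gp g0'' gq'' off2.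
(* If the hole through the longer arc is odd, its length forces [q = l], and then the other hole has
   length [2 * l], below the girth. *)
have ql : q = l.+1.
  case: (boolP (odd (l + q))) => o; first by have := odd_hole_length fc1 ch1 o; lia.
  have o2 : odd (l.+1 + q) by rewrite addSn.
  by have := odd_hole_length fc2 ch2 o2; have := fcycle_girth fc1; lia.
subst q; split=> //; exists g; split=> // t ht.
by have /and3P[] := gE t ht.
Qed.

End Family.

(** * Legs of an odd hole *)

Section ConnectedSets.
Variable G : sgraph.
Implicit Types (A B S : {set G}).

(** Connected sets, presented by adding one attached vertex at a time: this is the induction that
    the case of odd [l] runs on. *)
Inductive ctree : {set G} -> Prop :=
| ctree1 x : ctree [set x]
| ctreeU x y A : ctree A -> y \in A -> edge x y -> ctree (x |: A).

Lemma ctree_wlk A a b : ctree A -> a \in A -> b \in A -> exists n, wlk (redge A) n a b.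
Proof.
move=> tA; elim: tA a b => {A} [x|x y A _ IH yA xy] a b.
  by rewrite !inE => /eqP-> /eqP->; exists 0; rewrite /= eqxx.
have sA : A \subset x |: A by apply: subsetUr.
have toy z : z \in x |: A -> exists n, wlk (redge (x |: A)) n z y.
  rewrite !inE => /orP[/eqP->|zA].
    by exists 1; apply: wlk1; rewrite /redge xy !inE eqxx yA orbT.
  by have [n w] := IH z y zA yA; exists n; apply: sub_wlk (redge_sub sA) w.
move=> /toy[n wa] /toy[k wb]; exists (n + k).
exact: wlk_cat wa (wlk_sym (@redge_sym _ _) wb).
Qed.

(** While [B] is not exhausted, a walk inside [B] from [A] to a missing vertex has an edge leaving
    [A], whose outer end can be added. *)
Lemma ctree_grow A B : ctree A -> A \subset B ->
  (forall z, z \in B -> exists a n, a \in A /\ wlk (redge B) n a z) -> ctree B.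
Proof.
have [k] := ubnP #|B :\: A|; elim: k A => // k IH A hk tA AB hB.
have [BA|/subsetPn[z zB zA]] := boolP (B \subset A).
  by have /eqP <- : A == B by rewrite eqEsubset AB.
have [a [n [aA w]]] := hB z zB.
have [x [y [yA xA xB xy]]] : exists x y, [/\ y \in A, x \notin A, x \in B & edge x y].
  elim: n a aA w => [|n IHn] a aA /=; first by move/eqP=> az; rewrite az (negbTE zA) in aA.
  case/existsP=> u /andP[/and3P[au _ uB] uz].
  have [uA|uA] := boolP (u \in A); first exact: IHn uz.
  by exists u, a; rewrite edge_sym.
apply: (IH (x |: A)).
- have : B :\: (x |: A) \proper B :\: A.
    apply/properP; split; first by apply/setDS/subsetUr.
    by exists x; rewrite !inE ?xA ?xB ?eqxx.
  by move/proper_card; lia.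
- exact: ctreeU xy.
- by rewrite subUset sub1set xB.
by move=> v /hB[b [p [bA wb]]]; exists b, p; rewrite inE bA orbT.
Qed.

End ConnectedSets.

(** Heights change by at most one per step, so the path cannot reach [A] within [m] steps of either
    end. Its first [m] steps stay in [U] and its last [m] in [V]; as no edge joins [U] to [V], a
    middle vertex must exist and lie in [A]. *)
Lemma shallow_path (G : sgraph) (D : G -> nat) (U V A : {set G}) (g : nat -> G) l m :
  (forall x y, edge x y -> D x <= D y + 1) -> (forall x, x \in A -> D x = 0) ->
  2 * m <= l <= 2 * m + 1 ->
  (forall t, t <= l -> edge (g t) (g t.+1)) ->
  (forall t, t <= l.+1 -> [\/ g t \in U, g t \in V | g t \in A]) ->
  (forall x y, x \in U -> y \in V -> ~~ edge x y) ->
  g 0 \in U -> g l.+1 \in V -> D (g 0) = m.+1 -> D (g l.+1) = m.+1 ->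
  [/\ odd l, [/\ g m \in U, g m.+1 \in A & g m.+2 \in V],
      edge (g m) (g m.+1) & edge (g m.+1) (g m.+2)].
Proof.
move=> D_edge A0 ml gE gUVA nc g0 gl D0 Dl.
have D1 t : t <= l.+1 -> m.+1 <= D (g t) + t.
  elim: t => [|t IH] ht; first by rewrite D0; lia.
  by have := D_edge _ _ (gE t ht); have := IH (ltnW ht); lia.
have D2 t : t <= l.+1 -> m.+1 <= D (g (l.+1 - t)) + t.
  elim: t => [|t IH] ht; first by rewrite subn0 Dl; lia.
  have := gE (l - t) (leq_subr _ _); rewrite edge_sym -subSn // subSS.
  by move=> /D_edge; have := IH (ltnW ht); lia.
have gU t : t <= m -> g t \in U.
  elim: t => [|t IH] ht //; have tl : t <= l by lia.
  have := D1 t.+1 tl; case: (gUVA t.+1 tl) => // [|/A0]; last lia.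
  by move=> H; have := nc _ _ (IH (ltnW ht)) H; rewrite gE.
have gV t : t <= m -> g (l.+1 - t) \in V.
  elim: t => [|t IH] ht; first by rewrite subn0.
  have tl : t < l.+1 by lia.
  have := D2 t.+1 tl; rewrite subSS.
  case: (gUVA (l - t) (leqW (leq_subr _ _))) => // [|/A0]; last lia.
  by move=> H; have := nc _ _ H (IH (ltnW ht)); rewrite subSn ?gE ?leq_subr.
have gUm := gU m (leqnn _); have gVm := gV m (leqnn _).
have mi : m <= l by lia.
have Em := gE m mi.
have e2 : l.+1 - m = m.+1 \/ l = 2 * m + 1 /\ l.+1 - m = m.+2 by lia.
case: e2 gVm => [->|[l2 ->]] gVm; first by have := nc _ _ gUm gVm; rewrite Em.
have ml2 : m.+1 <= l by lia.
have Em' := gE _ ml2; split=> //; first by rewrite l2 oddD mul2n odd_double.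
case: (gUVA m.+1 (leqW ml2)) => // H.
  by have := nc _ _ H gVm; rewrite Em'.
by have := nc _ _ gUm H; rewrite Em.
Qed.

Section Legs.
Variables (l m : nat) (G : sgraph).
Hypotheses (hl : 2 <= l) (lm : l = odd l + 2 * m) (hG : in_family G l).
Variables (f : nat -> G) (D : G -> nat).
Hypotheses (fc : pcyc f (2 * l + 1)) (fD : forall t, D (f t) = m.+1).
Hypothesis D_edge : forall x y, edge x y -> D x <= D y + 1.
Hypothesis D_down : forall x, 0 < D x <= m.+1 ->
  exists y, edge x y && (D y == (D x).-1).

(** The default [x] is not reached at heights [1] to [m.+1], where [D_down] gives a lower
    neighbour. *)
Definition parent x := odflt x [pick y | edge x y && (D y == (D x).-1)].
Definition leg x t := iter t parent x.
(** For [x] on the hole, the leg stops at height one; the next step would enter the set of height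
    zero. *)
Definition leg_set x : {set G} := [set leg x (val t) | t : 'I_m.+1].

Lemma parentP x : 0 < D x <= m.+1 -> edge x (parent x) /\ D (parent x) = (D x).-1.
Proof.
move=> hx; rewrite /parent; case: pickP => [y /andP[xy /eqP Dy] //|h].
by have [y] := D_down hx; rewrite h.
Qed.

Lemma leg_height j t : t <= m.+1 -> D (leg (f j) t) = m.+1 - t.
Proof.
elim: t => [|t IH] ht; first by rewrite /leg /= fD subn0.
rewrite /leg iterS -/(leg (f j) t); have e := IH ltac:(lia).
by rewrite (parentP _).2 e; lia.
Qed.

Lemma leg_edge j t : t <= m -> edge (leg (f j) t) (leg (f j) t.+1).
Proof.
move=> ht; rewrite {2}/leg iterS -/(leg (f j) t).
by apply: (parentP _).1; rewrite leg_height; lia.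
Qed.

Lemma leg_setP x y : reflect (exists2 t, t <= m & y = leg x t) (y \in leg_set x).
Proof.
apply: (iffP imsetP) => [[t _ ->]|[t ht ->]]; first by exists (val t) => //; case: t.
by exists (Ordinal (ht : t < m.+1)).
Qed.

Lemma leg_set_low j y : y \in leg_set (f j) -> D y <= 1 -> y = leg (f j) m.
Proof.
by case/leg_setP=> s sm ->; rewrite leg_height => [h|]; [congr leg|]; lia.
Qed.

(** Two legs and a walk in [A] connect hole vertices at distance [l], so a shortest connection has
    length [l.+1]. Either the bottoms of the legs are adjacent, which is too short for odd [l], or
    [shallow_path] finds a middle vertex in [A]. *)
Lemma legs_join j (A : {set G}) a b n :
  (forall x, x \in A -> D x = 0) -> a \in A -> b \in A -> wlk (redge A) n a b ->
  edge (leg (f j) m) a -> edge (leg (f (j + l)) m) b ->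
  if odd l then exists2 x, x \in A & edge (leg (f j) m) x /\ edge (leg (f (j + l)) m) x
  else edge (leg (f j) m) (leg (f (j + l)) m).
Proof.
move=> A0 aA bA wab ea eb.
have [ml m0] : 2 * m <= l <= 2 * m + 1 /\ 0 < m by lia.
have hc := pcyc_shift j fc; set h := fun t => _ in hc.
have [eu ev] : h 0 = f j /\ h l = f (j + l) by rewrite /h addn0.
set u := f j in eu ea *; set v := f (j + l) in ev eb *.
have lowu := @leg_set_low j; have lowv := @leg_set_low (j + l).
have hu := leg_height j; have hv := leg_height (j + l).
have gu := @leg_edge j; have gv := @leg_edge (j + l).
rewrite -/u in lowu hu gu; rewrite -/v in lowv hv gv.
(* The height bound drops the tops of the legs, which lie on the hole. *)
pose X := [set x in leg_set u :|: leg_set v :|: A | D x <= m].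
have hD t : D (h t) = m.+1 by apply: fD.
have XD x : x \in X -> D x <= m by rewrite inE => /andP[].
have hX t : h t \notin X by apply/negP=> /XD; rewrite hD ltnn.
(* A neighbour of the hole in [X] has height [m > 0], so it is the second vertex of a leg, and the
   top of that leg is its only neighbour on the hole. *)
have Xn x t : x \in X -> edge x (h t) -> h t = h 0 \/ h t = h l.
  move=> xX xt; have Dx := XD _ xX; have := D_edge (x := h t) (y := x).
  rewrite edge_sym xt hD => /(_ isT) Dx'.
  have xh s : x != h s by apply: contraNneq (hX s) => <-.
  move: xX; rewrite !inE eu ev => /andP[+ _] => /orP[/orP[]|/A0]; last by lia.
    case/leg_setP=> s hs ex; have s1 : s = 1 by move: Dx Dx'; rewrite ex hu; lia.
    left; rewrite -eu; apply: (pcyc_one_neighbor hl hG hc xh xt).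
    by rewrite ex s1 edge_sym eu; apply: (gu 0).
  case/leg_setP=> s hs ex; have s1 : s = 1 by move: Dx Dx'; rewrite ex hv; lia.
  right; rewrite -ev; apply: (pcyc_one_neighbor hl hG hc xh xt).
  by rewrite ex s1 edge_sym ev; apply: (gv 0).
pose Y := h 0 |: (h l |: X).
have uY t : t <= m -> leg u t \in Y.
  case: t => [|t] ht; first by rewrite !inE eu eqxx.
  rewrite !inE; apply/orP; right; apply/orP; right.
  rewrite hu; last lia.
  apply/andP; split; last lia.
  by apply/orP; left; apply/orP; left; apply/leg_setP; exists t.+1.
have vY t : t <= m -> leg v t \in Y.
  case: t => [|t] ht; first by rewrite !inE ev eqxx orbT.
  rewrite !inE; apply/orP; right; apply/orP; right.
  rewrite hv; last lia.
  apply/andP; split; last lia.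
  by apply/orP; left; apply/orP; right; apply/leg_setP; exists t.+1.
have AY : A \subset Y.
  by apply/subsetP=> x xA; rewrite !inE xA (A0 _ xA) !orbT.
have YP x : x \in Y -> [\/ x \in leg_set u, x \in leg_set v | x \in A].
  rewrite !inE eu ev => /or3P[/eqP->|/eqP->|/andP[+ _]].
  - by constructor 1; apply/leg_setP; exists 0.
  - by constructor 2; apply/leg_setP; exists 0.
  - by case/orP=> [/orP[]|] H; [constructor 1|constructor 2|constructor 3].
have wu t : t <= m -> wlk (redge Y) t (h 0) (leg u t).
  move=> ht; have := @fun_wlk _ (redge Y) (leg u) 0 t; rewrite add0n eu; apply=> s hs.
  have [s1 s2] : s <= m /\ s < m by lia.
  by rewrite /redge (gu _ s1) (uY _ s1) (uY _ s2).
have wv t : t <= m -> wlk (redge Y) t (leg v t) (h l).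
  move=> ht; apply: (wlk_sym (@redge_sym _ _)).
  have := @fun_wlk _ (redge Y) (leg v) 0 t; rewrite add0n ev; apply=> s hs.
  have [s1 s2] : s <= m /\ s < m by lia.
  by rewrite /redge (gv _ s1) (vY _ s1) (vY _ s2).
have sAY := subsetP AY.
have ra : redge Y (leg u m) a by rewrite /redge ea uY ?sAY.
have rb : redge Y b (leg v m) by rewrite /redge edge_sym eb vY ?sAY.
have W := wlk_cat (wlk_cat (wlk_cat (wu m (leqnn _)) (wlk1 ra))
  (sub_wlk (redge_sub AY) wab)) (wlk_cat (wlk1 rb) (wv m (leqnn _))).
have [[g [g0 gl gE gX]] gmin] := pcyc_shortest_path hl hG hc hX Xn W.
have XY x : x \in X -> x \in Y by rewrite !in_setU1 => ->; rewrite !orbT.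
have [h0Y hlY] : h 0 \in Y /\ h l \in Y by rewrite !in_setU1 !eqxx orbT.
rewrite -/Y in gmin; clear W ra rb wab ea eb; clearbody Y X h u v.
(* Such an edge gives a connection of length [s + t + 1], which is at least [l.+1]; hence only the
   two bottoms can be adjacent. *)
have cross s t : s <= m -> t <= m -> edge (leg u s) (leg v t) -> l <= s + t.
  move=> hs ht e; have r : redge Y (leg u s) (leg v t) by rewrite /redge e uY ?vY.
  by have := gmin _ (wlk_cat (wlk_cat (wu s hs) (wlk1 r)) (wv t ht)); lia.
case: (boolP (edge (leg u m) (leg v m))) => [e|ne].
  by case: ifP => // o; have := cross m m (leqnn _) (leqnn _) e; lia.
have {cross} nc x y : x \in leg_set u -> y \in leg_set v -> ~~ edge x y.
  case/leg_setP=> s hs -> /leg_setP[t ht ->]; apply/negP=> e.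
  have H := cross s t hs ht e; have [es et] : s = m /\ t = m by lia.
  by rewrite es et (negbTE ne) in e.
have gY t : t <= l.+1 -> [\/ g t \in leg_set u, g t \in leg_set v | g t \in A].
  case: t => [|t] ht; first by apply: YP; rewrite g0.
  by case: (eqVneq t l) => [->|tl]; apply: YP; [rewrite gl|apply/XY/gX; lia].
have g0u : g 0 \in leg_set u by rewrite g0 eu; apply/leg_setP; exists 0.
have glv : g l.+1 \in leg_set v by rewrite gl ev; apply/leg_setP; exists 0.
have [||-> [gum gA gvm] Em Em'] := shallow_path D_edge A0 ml gE gY nc g0u glv.
- by rewrite g0 hD.
- by rewrite gl hD.
(* Its neighbours have height at most one, and the only such vertex of a leg is the bottom. *)
exists (g m.+1) => //; have Dg := A0 _ gA.
have d1 := D_edge Em; have := Em'; rewrite edge_sym => /D_edge; rewrite Dg in d1 * => d2.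
rewrite add0n in d1 d2; rewrite -(lowu _ gum d1) -(lowv _ gvm d2).
by rewrite Em edge_sym.
Qed.

(** A common neighbour closes the two legs and the hole edge to a walk of odd length
    [2 * m + 3 = l + 2], below the girth. *)
Lemma adjacent_legs_disjoint j x : odd l ->
  edge (leg (f j) m) x -> edge (leg (f j.+1) m) x -> False.
Proof.
move=> ol e1 e2; have l2 : l = 2 * m + 1 by lia.
have wl k : wlk (@edge G) m (f k) (leg (f k) m).
  have := @fun_wlk _ (@edge G) (leg (f k)) 0 m; rewrite add0n; apply=> t ht.
  by apply: leg_edge; lia.
have W2 := wlk_sym (@edge_sym G) (wlk_cat (wl j.+1) (wlk1 e2)).
have [_ _ fE _] := fc.
have W := wlk_cat (wlk_cat (wlk_cat (wl j) (wlk1 e1)) W2)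
  (wlk_sym (@edge_sym G) (wlk1 (fE j))).
by have := odd_closed_walk_length hl hG W; lia.
Qed.

(* When the last vertex [x] added to [A] is the only one adjacent to the leg
   of [f j] but all legs are reached, joining this leg to the legs of
   [f (j + l)] and [f (j + l + 1)] forces [x] to be adjacent to both of
   these, although they start at consecutive vertices. *)
Lemma ctree_misses_leg (A : {set G}) : odd l -> ctree A ->
  (forall x, x \in A -> D x = 0) ->
  exists j, [forall x in A, ~~ edge (leg (f j) m) x].
Proof.
(* Steps of [l], one and [l] make a full turn, so the leg of [f j] can be joined to both others. *)
move=> ol; have jE j : (j + l).+1 + l = j + (2 * l + 1) by lia.
elim=> {A} [x _|x y A tA IH yA xy Z].
  case: (boolP (edge (leg (f 0) m) x)) => e0.
    exists 1; apply/forall_inP=> y; rewrite inE => /eqP->.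
    by apply/negP=> e1; apply: (adjacent_legs_disjoint ol e0 e1).
  by exists 0; apply/forall_inP=> y; rewrite inE => /eqP->.
have [j /forall_inP hj] : exists j, [forall x in A, ~~ edge (leg (f j) m) x].
  by apply: IH => z zA; apply: Z; rewrite inE zA orbT.
have tB := ctreeU tA yA xy; set B := x |: A in tB Z *.
case: (boolP [forall x in B, ~~ edge (leg (f j) m) x]) => [h|]; first by exists j.
rewrite negb_forall_in => /exists_inP[x0 x0B]; rewrite negbK => x0j.
case: (boolP [forall x in B, ~~ edge (leg (f (j + l)) m) x]) => [h|].
  by exists (j + l).
rewrite negb_forall_in => /exists_inP[x1 x1B]; rewrite negbK => x1j.
case: (boolP [forall x in B, ~~ edge (leg (f (j + l).+1) m) x]) => [h|].
  by exists (j + l).+1.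
rewrite negb_forall_in => /exists_inP[x2 x2B]; rewrite negbK => x2j.
have xP z : z \in B -> edge (leg (f j) m) z -> z = x.
  by rewrite !inE => /orP[/eqP//|/hj /negbTE->].
have [n1 w1] := ctree_wlk tB x0B x1B; have [n2 w2] := ctree_wlk tB x2B x0B.
have fj : f ((j + l).+1 + l) = f j.
  by rewrite jE; case: fc.
have x0j' : edge (leg (f ((j + l).+1 + l)) m) x0 by rewrite fj.
have := legs_join Z x0B x1B w1 x0j x1j; rewrite ol => -[z zB [zj zl]].
have := legs_join Z x2B x0B w2 x2j x0j'; rewrite ol fj => -[z' z'B [z'l z'j]].
rewrite (xP _ zB zj) in zl; rewrite (xP _ z'B z'j) in z'l.
by case: (adjacent_legs_disjoint ol zl z'l).
Qed.

Lemma level_cycle_absurd : ctree [set x | D x == 0] ->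
  bipartite (induced [set x | D x == 1]) -> False.
Proof.
move=> tZ bL; set Z := [set x | _] in tZ.
have ZD x : x \in Z -> D x = 0 by rewrite inE => /eqP.
(* One further step down each leg enters [Z]; for odd [l] this contradicts [ctree_misses_leg]. *)
have wZ j : exists2 x, x \in Z & edge (leg (f j) m) x.
  exists (leg (f j) m.+1); last by apply: leg_edge.
  by rewrite inE leg_height // subnn.
case: (boolP (odd l)) => ol.
  have [j /forall_inP hj] := ctree_misses_leg ol tZ ZD.
  by have [x xZ e] := wZ j; have := hj _ xZ; rewrite e.
have step j : edge (leg (f j) m) (leg (f (j + l)) m).
  have [a aZ ea] := wZ j; have [b bZ eb] := wZ (j + l).
  have [n w] := ctree_wlk tZ aZ bZ.
  by have := legs_join ZD aZ bZ w ea eb; rewrite (negbTE ol).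
set L := [set x | _] in bL.
have wL j : leg (f j) m \in L by rewrite inE leg_height //; lia.
have [A hA] := bipartite_even_walk bL.
(* After [2 * l + 1] steps of [l] the index is a multiple of the period, so this odd walk is
   closed. *)
have W : wlk (redge L) (2 * l + 1) (leg (f (0 * l)) m) (leg (f ((0 + (2 * l + 1)) * l)) m).
  apply: (@fun_wlk _ (redge L) (fun k => leg (f (k * l)) m)) => t _.
  by rewrite /redge !wL mulSnr step.
have := hA _ _ _ W; rewrite add0n mul0n (pcyc_mod (_ * l) fc) modnMr addbb.
by lia.
Qed.

End Legs.

(** * Distance levels *)

Section Levels.
Variable G : sgraph.
Implicit Types (S : {set G}) (x y : G).

(** Growing balls by neighbourhoods lets their connectedness follow by induction on the radius. *)
Definition ball S k := iter k (fun A => A :|: [set x | [exists y in A, edge x y]]) S.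

Lemma ballS S k x : (x \in ball S k.+1) =
  (x \in ball S k) || [exists y in ball S k, edge x y].
Proof. by rewrite /ball iterS !inE. Qed.

Lemma ball_mono S k k' : k <= k' -> ball S k \subset ball S k'.
Proof.
move/subnK<-; elim: (k' - k) => [|p IH] //.
by apply: subset_trans IH _; apply/subsetP=> x xb; rewrite addSn ballS xb.
Qed.

Lemma ball_nbr S k x y : y \in ball S k -> edge x y -> x \in ball S k.+1.
Proof. by move=> yb xy; rewrite ballS; apply/orP; right; apply/exists_inP; exists y. Qed.

Lemma ball_wlk S k x : reflect (exists j y, [/\ j <= k, y \in S & wlk (@edge G) j x y])
  (x \in ball S k).
Proof.
apply: (iffP idP) => [|[j [y [jk yS w]]]].
  elim: k x => [|k IH] x; first by move=> xS; exists 0, x; rewrite /= eqxx.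
  rewrite ballS => /orP[/IH[j [y [jk yS w]]]|/exists_inP[z /IH[j [y [jk yS w]]] xz]].
    by exists j, y; split=> //; apply: leqW.
  by exists j.+1, y; split=> //; apply: wlkS w.
apply: (subsetP (ball_mono S jk)).
elim: j x w {jk} => [|j IH] x /=; first by move/eqP->.
by case/existsP=> z /andP[xz /IH zb]; apply: ball_nbr xz.
Qed.

Lemma walkE n x y : walk n x y = wlk (@edge G) n x y.
Proof.
apply/existsP/idP=> [[p /andP[]]|].
  case: p => p /= /eqP; elim: p n x => [|z p IH] [|n] x //= [sp].
  by case/andP=> xz zp yp; apply: wlkS xz _; apply: IH.
elim: n x => [|n IH] x /=; first by move=> xy; exists [tuple].
case/existsP=> z /andP[xz /IH[p /andP[zp yp]]].
by exists [tuple of z :: p]; rewrite /= xz zp.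
Qed.

Lemma levelP S i x : reflect (x \in ball S i /\ forall k, k < i -> x \notin ball S k)
  (x \in level S i).
Proof.
rewrite inE; apply: (iffP andP) => [[/exists_inP[y yS /andP[w _]] /forall_inP h]|[xi hi]].
  rewrite walkE in w; split; first by apply/ball_wlk; exists i, y.
  move=> k ki; apply/ball_wlk=> -[j [z [jk zS wz]]].
  have ex : exists j, walk j x z by exists j; rewrite walkE.
  case: (ex_minnP ex) => q wq qmin.
  have qj : q < i by have := qmin j; rewrite walkE wz => /(_ isT); lia.
  have /forallP/(_ (Ordinal qj))/negP[] := h z zS.
  rewrite /dist_is wq; apply/forallP=> p; apply/negP=> /qmin.
  by rewrite leqNgt ltn_ord.
have nw y j : y \in S -> j < i -> ~~ walk j x y.
  move=> yS ji; apply/negP; rewrite walkE => w.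
  by have /ball_wlk[] := hi j ji; exists j, y.
case/ball_wlk: xi => j [y [ji yS w]].
have e : j = i.
  apply/eqP; rewrite eqn_leq ji leqNgt; apply/negP=> ji'.
  by have := nw y j yS ji'; rewrite walkE w.
subst j; split.
  apply/exists_inP; exists y => //; rewrite /dist_is walkE w.
  by apply/forallP=> k; apply: nw.
apply/forall_inP=> z zS; apply/forallP=> k; rewrite /dist_is negb_and.
by rewrite nw.
Qed.

Lemma ctree_ball S k : S != set0 -> connected (induced S) -> ctree (ball S k).
Proof.
move=> /set0Pn[s sS] cS; elim: k => [|k IH].
  apply: (ctree_grow (ctree1 s)); first by rewrite sub1set.
  move=> z zS; have [n w] := connect_wlk (cS (exist _ s sS) (exist _ z zS)).
  by exists s, n; rewrite inE eqxx; split=> //; have := induced_wlk w.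
apply: (ctree_grow IH (ball_mono S (leqnSn k))) => z.
move=> zb; move: (zb); rewrite ballS => /orP[zk|/exists_inP[y yk zy]].
  by exists z, 0; rewrite zk /= eqxx.
exists y, 1; split=> //; apply: wlk1; rewrite /redge edge_sym zy zb andbT.
by rewrite (subsetP (ball_mono S (leqnSn k))).
Qed.

(* The distance to [S], capped at [K] so as to be defined also on vertices
   not connected to [S]. *)
Lemma capped_ex S K x : exists k, (x \in ball S k) || (k == K).
Proof. by exists K; rewrite eqxx orbT. Qed.

Definition capped_dist S K x := ex_minn (capped_ex S K x).

Lemma capped_dist_max S K x : capped_dist S K x <= K.
Proof. by rewrite /capped_dist; case: ex_minnP => k _; apply; rewrite eqxx orbT. Qed.

Lemma capped_dist_le S K x k : k < K -> (capped_dist S K x <= k) = (x \in ball S k).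
Proof.
rewrite /capped_dist; case: ex_minnP => d h dmin kK; apply/idP/idP => [dk|xk].
  case/orP: h => [xd|/eqP]; last by lia.
  exact: (subsetP (ball_mono S dk)).
by apply: dmin; rewrite xk.
Qed.

Lemma capped_dist_level S K x k : k < K -> (capped_dist S K x == k) = (x \in level S k).
Proof.
move=> kK; apply/eqP/levelP => [e|[xk h]].
  split=> [|j jk]; first by rewrite -(capped_dist_le S x kK) e.
  by rewrite -(@capped_dist_le S K) ?e -?ltnNge //; lia.
apply/eqP; rewrite eqn_leq capped_dist_le // xk /=; case: k kK xk h => // k kK xk h.
by rewrite ltnNge capped_dist_le ?h //; lia.
Qed.

Lemma capped_dist_edge S K x y : edge x y -> capped_dist S K x <= capped_dist S K y + 1.
Proof.
move=> xy; have := capped_dist_max S K x; rewrite addn1.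
case: (ltnP (capped_dist S K y).+1 K) => [h _|]; last by lia.
rewrite capped_dist_le //; apply: ball_nbr xy.
by rewrite -(@capped_dist_le S K) //; lia.
Qed.

Lemma capped_dist_down S K x : 0 < capped_dist S K x < K ->
  exists y, edge x y && (capped_dist S K y == (capped_dist S K x).-1).
Proof.
move=> h; set d := capped_dist S K x in h *.
have xd : x \in ball S d.-1.+1 by rewrite -(@capped_dist_le S K) -/d; lia.
move: xd; rewrite ballS -(@capped_dist_le S K) -/d; last lia.
case/orP=> [|/exists_inP[y yb xy]]; first by lia.
exists y; rewrite xy /=; have := capped_dist_edge S K xy; rewrite -/d.
by move: yb; rewrite -(@capped_dist_le S K); lia.
Qed.

End Levels.

(** * Bipartite levels and the colouring with four colours *)

Section Coloring.
Variables (l : nat) (G : sgraph).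
Hypotheses (hl : 2 <= l) (hG : in_family G l).
Implicit Types (S : {set G}).

Lemma level_bipartite S : S != set0 -> connected (induced S) ->
  (forall i, 1 <= i <= l./2 -> bipartite (induced (level S i))) ->
  forall i, 0 < i -> bipartite (induced (level S i)).
Proof.
move=> S0 cS low; elim/ltn_ind=> i IH i0.
case: (leqP i l./2) => il; first by apply: low; rewrite i0.
apply: not_bipartite_odd_cycle => f k ok fc ch fL.
have ek := odd_hole_length hl hG fc ch ok; subst k.
have pc := fcycle_pcyc fc ch.
(* Truncated subtraction collapses the ball of radius [i - (l./2).+1] to height zero and puts level
   [i] at height [(l./2).+1]; the cap [i.+1] lies just above level [i]. *)
pose D x := capped_dist S i.+1 x - (i - (l./2).+1).
have n0 : 0 < 2 * l + 1 by lia.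
have D1 : [set x | D x == 1] = level S (i - l./2).
  by apply/setP=> x; rewrite inE -(@capped_dist_level _ S i.+1) /D; lia.
have D0 : [set x | D x == 0] = ball S (i - (l./2).+1).
  by apply/setP=> x; rewrite inE -(@capped_dist_le _ S i.+1) /D; lia.
apply: (@level_cycle_absurd l l./2 G hl _ hG _ D pc); first by lia.
- move=> t; have := fL _ (ltn_pmod t n0).
  by rewrite -(@capped_dist_level _ S i.+1) // /D => /eqP->; lia.
- by move=> x y /(capped_dist_edge S i.+1); rewrite /D; lia.
- move=> x; rewrite /D => hx.
  have [|y /andP[xy /eqP ey]] := @capped_dist_down _ S i.+1 x; first by lia.
  by exists y; rewrite xy ey; lia.
- by rewrite D0; apply: ctree_ball.
- by rewrite D1; apply: IH; lia.
Qed.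

(** An edge inside the level and two walks to [r] of length exactly [i] close an odd walk of length
    [2 * i + 1], below the girth. So the level has no edges. *)
Lemma low_level_root_bipartite (r : G) i : i < l -> bipartite (induced (level [set r] i)).
Proof.
move=> il; exists set0 => -[x xL] [y yL] xy; exfalso; have {}xy : @edge G x y := xy.
case/levelP: xL => /ball_wlk[j [z [ji /set1P-> wx]]] hx.
case/levelP: yL => /ball_wlk[k [z' [ki /set1P-> wy]]] hy.
have ej : j = i.
  apply/eqP; rewrite eqn_leq ji leqNgt; apply/negP=> /hx.
  by move/ball_wlk; case; exists j, r; rewrite inE eqxx.
have ek : k = i.
  apply/eqP; rewrite eqn_leq ki leqNgt; apply/negP=> /hy.
  by move/ball_wlk; case; exists k, r; rewrite inE eqxx.
subst j k; have W := wlk_cat (wlk_cat (wlk_sym (@edge_sym G) wx) (wlk1 xy)) wy.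
by have := odd_closed_walk_length hl hG W; lia.
Qed.

Lemma four_colorable : colorable G 4.
Proof.
have bip (r : G) i : bipartite (induced (level [set r] i)).
  case: (posnP i) => [->|i0]; first by apply: low_level_root_bipartite; lia.
  apply: level_bipartite i0; last by move=> j hj; apply: low_level_root_bipartite; lia.
    by apply/set0Pn; exists r; rewrite inE.
  move=> [x xr] [y yr]; rewrite (_ : exist _ x xr = exist _ y yr) ?connect0 //.
  by apply: val_inj => /=; move/set1P: (xr) => ->; move/set1P: (yr) => ->.
pose rt := root (@edge G).
have sc : connect_sym (@edge G) := sym_connect_sym (@edge_sym G).
have reach x : exists k, x \in ball [set rt x] k.
  have [n w] := connect_wlk (connect_root (@edge G) x).
  by exists n; apply/ball_wlk; exists n, (rt x); rewrite inE eqxx.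
pose d x := ex_minn (reach x).
have dL x : x \in level [set rt x] (d x).
  rewrite /d; case: ex_minnP => k xk kmin; apply/levelP; split=> // j jk.
  by apply/negP=> /kmin; lia.
have rtE x y : edge x y -> rt x = rt y.
  by move=> xy; apply/eqP; rewrite root_connect // connect1.
have dE x y : edge x y -> d x <= d y + 1.
  move=> xy; rewrite addn1 {1}/d; case: ex_minnP => k _; apply.
  by rewrite (rtE _ _ xy); apply: ball_nbr xy; case/levelP: (dL y).
(* This fixes one bipartition per root and level, shared by all its vertices; by [bip] the default
   never occurs. *)
pose side (r : G) i := odflt set0 [pick B : {set induced (level [set r] i)} |
  [forall x, [forall y, edge x y ==> ((x \in B) != (y \in B))]]].
have sideP r i (x y : induced (level [set r] i)) :
    edge x y -> (x \in side r i) != (y \in side r i).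
  move=> xy; rewrite /side; case: pickP => [B /forallP/(_ x)/forallP/(_ y)/implyP/(_ xy) //|].
  have [B hB] := bip r i; move/(_ B)/negbT/negP; case.
  by apply/forallP=> u; apply/forallP=> v; apply/implyP; apply: hB.
pose c (x : G) := (odd (d x)).*2 + (x \in [set val z | z in side (rt x) (d x)]).
have c4 x : c x < 4 by rewrite /c; case: (odd _); case: (_ \in _).
apply/existsP; exists [ffun x => Ordinal (c4 x)].
apply/forallP=> x; apply/forallP=> y; apply/implyP=> xy; rewrite !ffunE.
apply/negP=> /eqP/(congr1 val) /=; rewrite /c.
have := dE _ _ xy; have := dE y x; rewrite edge_sym xy => /(_ isT) d1 d2.
have yL := dL y; rewrite -(rtE _ _ xy) in yL *.
(* Distances of adjacent vertices differ by at most one: if they differ, so do their parities; if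
   not, both vertices share a level and the sides differ. *)
case: (eqVneq (d x) (d y)) => [e|ne]; last by move: ne d1 d2; do 2 case: (_ \in _); lia.
rewrite -e in yL *; have := sideP _ _ (exist _ x (dL x)) (exist _ y yL) xy.
have mE u (uL : u \in level [set rt x] (d x)) :
    (u \in [set val z | z in side (rt x) (d x)]) = (exist _ u uL \in side (rt x) (d x)).
  exact: (mem_imset _ (exist _ u uL) val_inj).
by rewrite -!mE; do 2 case: (_ \in _); lia.
Qed.

End Coloring.

(** * Deleting an edge *)

Lemma hole_pcyc (G : sgraph) (x0 : G) (c : seq G) : is_hole c ->
  pcyc (fun t => nth x0 c (t %% size c)) (size c).
Proof.
case=> /and3P[c3 cU cc] _ ch; set n := size c; set f := fun t => _.
have n0 : 0 < n by lia.
have fc t : f t \in c by rewrite /f mem_nth // ltn_pmod.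
have fn t : next c (f t) = f t.+1.
  rewrite next_nth fc index_uniq ?ltn_pmod // /f -(addn1 t) -modnDml addn1.
  move: (ltn_pmod t n0); rewrite /n; move: (t %% _).
  case: (c) => // z c' u; rewrite leq_eqVlt => /orP[/eqP un|un].
    by rewrite un modnn /= nth_default //; move: un => /=; lia.
  by rewrite modn_small //= (set_nth_default x0) //.
have fI i j : i < j < i + n -> f i != f j.
  move=> ij; rewrite /f nth_uniq ?ltn_pmod //; apply/eqP=> e.
  have : j - i = 0 %[mod n].
    by apply/eqP; rewrite mod0n -/(dvdn n (j - i)) -eqn_mod_dvd ?e; [|lia].
  by rewrite mod0n modn_small; lia.
split=> // [t|t|i j ij]; first by rewrite /f modnDr.
  by rewrite -fn; apply: next_cycle.
split=> [|e]; first exact: fI.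
have /and3P[_ _] := ch _ _ (fc i) (fc j) e; rewrite !fn => /orP[]/eqP e'.
  left; case: (eqVneq j i.+1) => // ne.
  by have := fI i.+1 j ltac:(lia); rewrite e' eqxx.
right; case: (eqVneq j.+1 (i + n)) => // ne.
have := fI j.+1 (i + n) ltac:(lia).
by rewrite e' /f modnDr eqxx.
Qed.

Lemma set2_inj (T : finType) (u v x y : T) : u != v -> [set u; v] = [set x; y] ->
  (u = x /\ v = y) \/ (u = y /\ v = x).
Proof.
move=> uv e; have := set21 u v; have := set22 u v; rewrite e !inE.
move=> /orP[]/eqP ev /orP[]/eqP eu; subst u v; rewrite ?eqxx in uv; by [left|right|].
Qed.

Section EdgeDeletion.
Variables (G : sgraph) (x y : G).
Hypothesis xy : edge x y.
Let H := del_edge x y.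

Lemma del_edge_sub : subrel (@edge H) (@edge G).
Proof. by move=> u v /andP[]. Qed.

(** The deleted edge closes the arc from [f 0] to [f r]. Any other edge of [G] on the arc survives
    in [H], so it joins consecutive vertices; neither arc is a single edge, as [H] lacks the
    edge. *)
Lemma del_edge_chord (f : nat -> G) n r : pcyc (G := H) f n -> 0 < r < n ->
  [set f 0; f r] = [set x; y] -> fcycle f r.+1 /\ chordless f r.+1.
Proof.
case=> n3 fP fE fI rn exy.
have fI' i j : i < n -> j < n -> f i = f j -> i = j.
  move=> hi hj e; case: (ltngtP i j) => // ij.
    by have [] := fI i j ltac:(lia); rewrite e eqxx.
  by have [] := fI j i ltac:(lia); rewrite e eqxx.
have r1 : r != 1.
  by apply/eqP=> r1; have := fE 0; rewrite -r1 /= /del_edge_rel exy eqxx andbF.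
have rn1 : r.+1 != n.
  apply/eqP=> r1n; have := fE r; rewrite r1n -[n]add0n fP.
  by rewrite /= /del_edge_rel setUC exy eqxx andbF.
have eG : @edge G (f 0) (f r).
  have ne : f 0 != f r by apply: (fI _ _ _).1; lia.
  by case: (set2_inj ne exy) => -[-> ->] //; rewrite edge_sym.
split; [split|].
- lia.
- by move=> t _; apply: del_edge_sub.
- by rewrite edge_sym.
- by move=> i j ij; apply: (fI _ _ _).1; lia.
move=> i j ij e; have [ne h] := fI i j ltac:(lia).
case: (eqVneq [set f i; f j] [set x; y]) => [e2|ne2].
  rewrite -exy in e2; have [hi hj hr h0] : [/\ i < n, j < n, r < n & 0 < n] by split; lia.
  right; case: (set2_inj ne e2) => -[]; first by move=> /(fI' _ _ hi h0) -> /(fI' _ _ hj hr) ->.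
  move=> /(fI' _ _ hi hr) ei /(fI' _ _ hj h0) ej.
  by rewrite ei ej ltn0 in ij.
have := h (introT andP (conj e ne2)).
by move: ij rn rn1; clear; lia.
Qed.

Lemma del_edge_in_family l : 2 <= l -> in_family G l ->
  ~ (exists c : seq G, [/\ is_cycle c, size c = 2 * l + 1 & cycle_edge c x y]) ->
  in_family H l.
Proof.
move=> hl hG nc.
have edge_neq (u v : G) : edge u v -> u != v.
  by move=> e; apply: contraTneq e => ->; rewrite edge_irrefl.
have cyc (c : seq G) : is_cycle (c : seq H) -> is_cycle c.
  by case/and3P=> c3 cU cc; apply/and3P; split=> //; apply: sub_cycle del_edge_sub _ cc.
split; first split.
(* A shortest cycle of [G] has length [2 * l + 1], so by hypothesis it avoids the deleted edge and
   survives. *)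
- have [[c cc sc] _] := hG.1; exists c => //.
  have [c3 cU ce] := and3P cc; apply/and3P; split=> //.
  apply: cycle_from_next => // u uc; have e := next_cycle ce uc.
  apply/andP; split=> //; apply/eqP=> /(set2_inj (edge_neq _ _ e)) es.
  case: nc; exists c; split=> //; rewrite /cycle_edge.
  by case: es => -[<- <-]; rewrite uc mem_next uc eqxx ?orbT.
- by move=> c /cyc; apply: hG.1.2.
case=> c [hc oc lc]; have [cc c4 ch] := hc.
(* A hole that misses an end of the deleted edge gains no chord in [G]. *)
case: (boolP ((x \in c) && (y \in c))) => [/andP[xc yc]|xyc]; last first.
  case: hG.2; exists c; split=> //; split=> // [|u v uc vc uv]; first exact: cyc.
  apply: ch => //; apply/andP; split=> //; apply: contra xyc => /eqP e.
  by case: (set2_inj (edge_neq _ _ uv) e) => -[<- <-]; rewrite uc vc.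
have := @hole_pcyc H x c hc; set n := size c in oc lc c4 *; set f := fun t => _.
move=> pc; have [_ fP _ _] := pc.
(* The closed arc is an odd hole of [G], hence a cycle of length [2 * l + 1] that contains the edge
   [x y]. *)
have key a r : 0 < r < n -> [set f a; f (a + r)] = [set x; y] -> odd r.+1 -> False.
  move=> rn exy o; set g := fun t => f (a + t).
  have gxy : [set g 0; g r] = [set x; y] by rewrite /g addn0.
  have [gc gch] := del_edge_chord (pcyc_shift a pc) rn gxy.
  have rl := odd_hole_length hl hG gc gch o.
  have r4 : 4 <= r.+1 by rewrite rl; move: hl; clear; lia.
  have [h1 _ h3] := fcycle_hole r4 gc gch.
  have gm t : t < r.+1 -> g t \in mkseq g r.+1.
    by move=> tr; apply: map_f; rewrite mem_iota.
  case: nc; exists (mkseq g r.+1); rewrite size_mkseq; split=> //.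
  have mxy : {subset [set x; y] <= mkseq g r.+1}.
    by move=> z; rewrite -gxy => /set2P[]->; apply: gm.
  by apply: h3 => //; apply: mxy; rewrite !inE eqxx ?orbT.
have idx z : z \in c -> exists2 i, i < n & f i = z.
  move=> zc; exists (index z c); rewrite ?index_mem // /f modn_small ?index_mem //.
  exact: nth_index.
have [i hi fi] := idx _ xc; have [j hj fj] := idx _ yc.
have ij : i != j by apply: contraTneq (edge_neq _ _ xy) => e; rewrite -fi -fj e eqxx.
(* The two closed arcs have total length [n + 2], which is odd, so one of them is odd. *)
have both a b : a < b < n -> [set f a; f b] = [set x; y] -> False.
  move=> ab e; case: (boolP (odd (b - a).+1)) => o.
    by apply: (key a (b - a)) o; [lia|rewrite subnKC //; lia].
  apply: (key b (n - (b - a))); [lia| |lia].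
  by rewrite (_ : b + _ = a + n) ?fP 1?setUC //; lia.
case: (ltngtP i j) ij => // h _.
  by apply: (both i j); rewrite ?h // fi fj.
by apply: (both j i); rewrite ?h // fi fj setUC.
Qed.

End EdgeDeletion.

Theorem theorem1p2 (l : nat) (hl : 2 <= l) (G : sgraph) (hG : in_family G l)
    (S : {set G}) (hS0 : S != set0) (hS : connected (induced S)) :
  [/\ (forall x y : G, edge x y ->
         ~ (exists c : seq G,
              [/\ is_cycle c, size c = 2 * l + 1 & cycle_edge c x y]) ->
         in_family (del_edge x y) l),
      ((forall i : nat, 1 <= i <= l./2 -> bipartite (induced (level S i))) ->
       forall i : nat, 0 < i -> bipartite (induced (level S i)))
    & chromatic_number G <= 4].
Proof.
split; last 1 first.
- rewrite /chromatic_number; case: ex_minnP => k _; apply.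
  exact: four_colorable hl hG.
- by move=> x y xy; apply: del_edge_in_family.
- exact: level_bipartite.
Qed.
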